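(* Let $G$ be a graph of order $n$ with minimum degree $\delta>0$. Then $$ \gamma_R(G)\le 2\left(1-\frac{2^{1/\delta}\,\delta}{(1+\delta)^{1+1/\delta}}\right)n . $$
   Context: All graphs are finite and undirected, without loops or multiple edges. A Roman dominating function of a graph $G$ is a function $f:V(G)\to\{0,1,2\}$ such that every vertex $u$ with $f(u)=0$ is adjacent to at least one vertex $v$ with $f(v)=2$. Its weight is $f(V(G))=\sum_{v\in V(G)}f(v)$. The Roman domination number $\gamma_R(G)$ is the minimum weight of a Roman dominating function of $G$. *)

(* Defs.v *)
From mathcomp Require Import all_boot.

Set Implicit Arguments.
Unset Strict Implicit.
Unset Printing Implicit Defensive.

Record sgraph := SGraph {
  vertex :> finType;
  adj : rel vertex;
  adj_sym : symmetric adj;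
  adj_irrefl : irreflexive adj }.

Definition degree (G : sgraph) (v : G) : nat := #|[set u | adj v u]|.

(* The default value #|G| exceeds every degree, so on a nonempty graph this is
   the true minimum (min_degreeP); on the graph without vertices it is 0. *)
Definition min_degree (G : sgraph) : nat :=
  \big[minn/#|G|]_(v : G) degree v.

Definition roman_dominating (G : sgraph) (f : {ffun G -> 'I_3}) : bool :=
  [forall u : G, (f u == 0 :> nat) ==>
     [exists v : G, adj u v && (f v == 2 :> nat)]].

Definition weight (G : sgraph) (f : {ffun G -> 'I_3}) : nat :=
  \sum_(v : G) f v.

(* The starting point of the minimisation, the constant function 2, is always
   Roman dominating, so this is the true minimum (roman_domination_numberP). *)
Definition roman_domination_number (G : sgraph) : nat :=
  weight [arg min_(f < [ffun _ : G => (ord_max : 'I_3)]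
                     | roman_dominating f) weight f].

Lemma min_degreeP (G : sgraph) : 0 < #|G| ->
  (forall v : G, min_degree G <= degree v) /\
  (exists v : G, degree v = min_degree G).
Proof.
have ltdeg (v : G) : degree v < #|G|.
  have Hp : [set u | adj v u] \proper [set: G].
    by rewrite properT; apply/eqP=> /setP/(_ v); rewrite !inE adj_irrefl.
  by rewrite -[ltnRHS]cardsT; exact: proper_card Hp.
have le_min (v : G) : min_degree G <= degree v.
  rewrite /min_degree; have := mem_index_enum v.
  elim: (index_enum _) => [//|u r IH]; rewrite inE big_cons geq_min.
  by case/predU1P=> [->|/IH ->]; rewrite ?leqnn ?orbT.
move=> /card_gt0P [v0 _]; split=> //.
have [E|//] : min_degree G = #|G| \/ exists v : G, degree v = min_degree G.
  rewrite /min_degree; elim/big_ind: _ => [|x y Hx Hy|v _]; first by left.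
    by rewrite /minn; case: ifP.
  by right; exists v.
by have := ltdeg v0; rewrite ltnNge -E le_min.
Qed.

Lemma roman_domination_numberP (G : sgraph) :
  (forall f : {ffun G -> 'I_3}, roman_dominating f ->
     roman_domination_number G <= weight f) /\
  (exists2 f : {ffun G -> 'I_3}, roman_dominating f &
     weight f = roman_domination_number G).
Proof.
rewrite /roman_domination_number; case: arg_minnP => [|f rf minf].
  by apply/forallP=> u; rewrite ffunE.
by split=> //; exists f.
Qed.

(* Main.v *)
(** Put each vertex in a set A independently with probability 1 - q. Giving 2 to
    the vertices of A and 1 to the vertices with no closed neighbour in A is
    Roman dominating, with expected weight at most (2 (1 - q) + q^(delta + 1)) n.
    This bound is minimal at q = (2 / (1 + delta))^(1 / delta). *)

Require Import Defs.
From mathcomp Require Import all_boot all_order all_algebra.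
From mathcomp Require Import ring lra.
From mathcomp Require Import reals exp.
Import Order.TTheory GRing.Theory Num.Theory.
Local Open Scope ring_scope.

Definition closed_nbhd {G : sgraph} (v : G) : {set G} := v |: [set u | adj v u].

Lemma card_closed_nbhd (G : sgraph) (v : G) : #|closed_nbhd v| = (degree v).+1.
Proof. by rewrite cardsU1 inE adj_irrefl. Qed.

(** If a vertex has value 0, it lies outside [A] while its closed neighbourhood meets [A], so the
    common vertex is a proper neighbour, and it has value 2. *)
Lemma roman_domination_number_le_set (G : sgraph) (A : {set G}) :
  (roman_domination_number G <=
     \sum_(v : G) (2 * (v \in A) + [disjoint closed_nbhd v & A]))%N.
Proof.
pose f : {ffun G -> 'I_3} :=
  [ffun v => inord (2 * (v \in A) + [disjoint closed_nbhd v & A])].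
(* Each vertex lies in its own closed neighbourhood, so the two summands are never both positive:
   the value is at most 2 and [inord] preserves it. *)
have disjF v : v \in A -> [disjoint closed_nbhd v & A] = false.
  by move=> vA; apply/negbTE/pred0Pn; exists v; rewrite /= vA andbT setU11.
have fE v : f v = (2 * (v \in A) + [disjoint closed_nbhd v & A])%N :> nat.
  rewrite ffunE inordK //; case: (boolP (v \in A)) => [/disjF -> //|_].
  by case: [disjoint _ & _].
have rf : roman_dominating f.
  apply/forallP => u; apply/implyP; rewrite fE.
  case: (boolP (u \in A)) => // uA; case: (boolP [disjoint _ & _]) => // + _.
  case/pred0Pn => v /= /andP[]; rewrite in_setU1 => /predU1P[->|].
    by rewrite (negbTE uA).
  rewrite inE => uv vA.
  by apply/existsP; exists v; rewrite uv fE vA disjF.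
have [le_f _] := roman_domination_numberP G.
by apply: leq_trans (le_f f rf) _; apply: leq_sum => v _; rewrite fE.
Qed.

Section RandomSubset.
Variables (R : comPzRingType) (T : finType) (q : R).

(** Here [q] is the probability of leaving an element out, so that avoiding a set has a pure power
    of [q] as its probability. *)
Definition subset_prob (A : {set T}) : R :=
  \prod_(u : T) (if u \in A then 1 - q else q).

Lemma subset_prob_disjoint (S : {set T}) :
  \sum_(A : {set T}) subset_prob A * [disjoint S & A]%:R = q ^+ #|S|.
Proof.
have -> : q ^+ #|S| = \prod_(u : T) ((if u \in S then 0 else 1 - q) + q).
  rewrite -prodr_const big_mkcond; apply: eq_bigr => u _.
  by case: ifP => _; rewrite ?add0r // subrK.
(* Expanding the product, [A] collects the indices where the first summand is chosen; the factor 0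
   kills every [A] that meets [S]. *)
rewrite bigA_distr; apply: eq_bigr => A _.
case: (boolP [disjoint S & A]) => [dSA|/pred0Pn[u /= /andP[uS uA]]].
  rewrite mulr1; apply: eq_bigr => u _; case: ifP => // uA.
  by rewrite (disjointFl dSA uA).
by rewrite mulr0 (bigD1 u) //= uA uS mul0r.
Qed.

Lemma subset_prob_sum1 : \sum_(A : {set T}) subset_prob A = 1.
Proof.
rewrite -[RHS](expr0 q) -(cards0 T) -subset_prob_disjoint.
by apply: eq_bigr => A _; rewrite disjoints_subset sub0set mulr1.
Qed.

(** Complement of the event that [A] misses the singleton of [v]. *)
Lemma subset_prob_mem (v : T) :
  \sum_(A : {set T}) subset_prob A * (v \in A)%:R = 1 - q.
Proof.
rewrite -[q in RHS]expr1 -(cards1 v) -subset_prob_disjoint.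
rewrite -[X in X - _]subset_prob_sum1 -sumrB.
apply: eq_bigr => A _; rewrite disjoints1.
by case: (v \in A); rewrite ?mulr0 ?mulr1 ?subr0 ?subrr.
Qed.

End RandomSubset.

Lemma subset_prob_ge0 (R : numDomainType) (T : finType) (q : R) (A : {set T}) :
  0 <= q <= 1 -> 0 <= subset_prob R T q A.
Proof.
case/andP=> q0 q1; apply: prodr_ge0 => u _.
by case: ifP => _ //; rewrite subr_ge0.
Qed.

Lemma roman_domination_number_le_expect (R : numDomainType) (G : sgraph) (q : R) :
  0 <= q <= 1 ->
  (roman_domination_number G)%:R <=
    \sum_(v : G) (2 * (1 - q) + q ^+ (degree v).+1).
Proof.
move=> q01.
(* The constant left side is written as its own expectation, so that the bound for each [A] can be
   averaged term by term. *)
rewrite -[leLHS]mul1r -[X in X * _ <= _](subset_prob_sum1 R G q) mulr_suml.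
pose w A := \sum_(v : G) (2 * (subset_prob R G q A * (v \in A)%:R) +
  subset_prob R G q A * [disjoint closed_nbhd v & A]%:R).
apply: (@le_trans _ _ (\sum_(A : {set G}) w A)).
  apply: ler_sum => A _.
  have -> : w A = subset_prob R G q A *
      (\sum_(v : G) (2 * (v \in A) + [disjoint closed_nbhd v & A]))%N%:R.
    rewrite natr_sum mulr_sumr; apply: eq_bigr => v _.
    by rewrite natrD natrM mulrDr mulrCA.
  by rewrite ler_wpM2l ?subset_prob_ge0 // ler_nat roman_domination_number_le_set.
(* Linearity of expectation: summing over [A] first leaves the two probabilities at each vertex. *)
rewrite /w exchange_big /= le_eqVlt; apply/orP; left; apply/eqP.
apply: eq_bigr => v _; rewrite big_split /= -mulr_sumr.
by rewrite subset_prob_mem subset_prob_disjoint card_closed_nbhd.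
Qed.

Lemma roman_domination_number_le_min_degree (R : numDomainType) (G : sgraph)
    (q : R) :
  0 <= q <= 1 ->
  (roman_domination_number G)%:R <=
    (2 * (1 - q) + q ^+ (min_degree G).+1) * #|G|%:R.
Proof.
move=> q01; apply: le_trans (roman_domination_number_le_expect R G q q01) _.
rewrite mulr_natr -[#|G|]/#|xpredT : pred G| -sumr_const.
apply: ler_sum => v _; rewrite lerD2l.
have [|le_deg _] := @min_degreeP G; first by apply/card_gt0P; exists v.
(* Powers of [q] in [0, 1] decrease with the exponent, so the minimum degree is the worst case. *)
by case/andP: q01 => q0 q1; apply: ler_wiXn2l => //; rewrite ltnS.
Qed.

Theorem theorem12 (R : realType) (G : sgraph) (n delta : nat)
    (order_G : #|G| = n) (min_degree_G : min_degree G = delta)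
    (delta_gt0 : (0 < delta)%N) :
  (roman_domination_number G)%:R <=
    2 * (1 - (2 `^ (1 / delta%:R) * delta%:R)
             / (1 + delta%:R) `^ (1 + 1 / delta%:R)) * n%:R :> R.
Proof.
set d : R := delta%:R.
have d1 : 1 <= d by rewrite ler1n.
have dS0 : 0 < 1 + d by lra.
have dSn0 : 1 + d != 0 by exact: lt0r_neq0.
(* The zero of the derivative (1 + d) q^d - 2 of 2 (1 - q) + q^(d + 1). *)
pose q : R := (2 / (1 + d)) `^ (1 / d).
have qd : q ^+ delta = 2 / (1 + d).
  rewrite -powR_mulrn ?powR_ge0 // -powRrM div1r mulVf ?powRr1 ?lt0r_neq0 //; last lra.
  by rewrite divr_ge0 //; lra.
have q0 : 0 <= q by exact: powR_ge0.
have q1 : q <= 1.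
  (* This amounts to 2 <= 1 + d, that is, to a positive minimum degree. *)
  by rewrite -(@expr_le1 _ delta) // qd ler_pdivrMr //; lra.
have := @roman_domination_number_le_min_degree R G q.
rewrite q0 q1 order_G min_degree_G => /(_ isT) /le_trans; apply.
(* Since q^(d + 1) = 2 q / (1 + d), the bound equals 2 (1 - q d / (1 + d)) n; what remains is to
   rewrite the real powers. *)
suff -> : 2 `^ (1 / d) * d / (1 + d) `^ (1 + 1 / d) = q * d / (1 + d).
  by rewrite exprS qd le_eqVlt; apply/orP; left; apply/eqP; field.
have -> : q = 2 `^ (1 / d) / (1 + d) `^ (1 / d).
  apply: (canRL (mulfK _)); first by rewrite gt_eqF ?powR_gt0.
  rewrite /q -powRM ?divr_ge0 //; [|lra..].
  by rewrite divfK // gt_eqF.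
rewrite powRD; last by rewrite dSn0 implybT.
rewrite powRr1; last lra.
have : (1 + d) `^ (1 / d) != 0 by rewrite gt_eqF ?powR_gt0.
by move=> p0; field; rewrite p0 dSn0.
Qed.
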